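(* Let $(E,R)$ and $(E',R')$ be two relation sets and let $\varphi:[E]\to[E']$ be an isomorphism of $\mathbb{F}_2$-vector spaces such that $\varphi([E]_c)=[E']_c$. Write $\mathcal N=\mathcal N(E,R)$ and $\mathcal N'=\mathcal N(E',R')$ for the sets of kernels. Then: (1) $\varphi$ induces an isomorphism of relation sets $\varphi_{\mathcal N}:(\mathcal N,R_{\mathcal P})\to(\mathcal N',R'_{\mathcal P})$, given by $N\mapsto N'$ where $N'$ is the element of $\mathcal N'$ such that $\varphi([\mathrm{Cel}(N)])=[\mathrm{Cel}(N')]$; moreover $\varphi_{\mathcal N}$ preserves cardinality, i.e. $N$ and $\varphi_{\mathcal N}(N)$ have the same cardinality for all $N\in\mathcal N$. (2) The relation sets $(E,R)$ and $(E',R')$ are isomorphic.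
   Context: A relation set is a pair $(E,R)$ with $E$ a set (finite or infinite) and $R$ a reflexive symmetric binary relation on $E$. An isomorphism of relation sets $(E,R)\to(E',R')$ is a bijection $f:E\to E'$ with $(f\times f)(R)=R'$. For $X\subseteq E$ put $C(X)=\{y\in E\mid \forall x\in X,\ xRy\}$; $C^2=C\circ C$, and $C^2(x)=C^2(\{x\})$ for $x\in E$. A subset $X\subseteq E$ is commutative if its elements are pairwise in relation $R$. $[E]$ is the set of finite subsets of $E$, an $\mathbb F_2$-vector space under symmetric difference (with basis the singletons), and $[E]_c$ is the set of commutative finite subsets of $E$; for $T\subseteq E$, $[T]$ is the subspace of finite subsets of $T$. The cells of $(E,R)$ are the sets $C^2(x)$, $x\in E$. The kernels of $(E,R)$ are the equivalence classes of the relation on $E$: $x\equiv y\iff C^2(x)=C^2(y)$ (equivalently $C(\{x\})=C(\{y\})$). $\mathcal N(E,R)$ is the set of kernels. For a kernel $N$, $\mathrm{Cel}(N)$ is the common cell $C^2(x)$ of the elements $x\in N$. For $X,Y\subseteq E$, $X R_{\mathcal P} Y$ means $xRy$ for all $(x,y)\in X\times Y$; kernels are commutative subsets, so $R_{\mathcal P}$ is reflexive and symmetric on $\mathcal N(E,R)$ and $(\mathcal N(E,R),R_{\mathcal P})$ is a relation set. The same notation is used for $(E',R')$, with $R'_{\mathcal P}$ the relation obtained from $R'$. *)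

(* Defs.v *)
From HB Require Import structures.
From mathcomp Require Import all_boot all_order all_algebra.
From mathcomp Require Import boolp classical_sets functions cardinality.
Set Implicit Arguments.
Unset Strict Implicit.
Unset Printing Implicit Defensive.
Import GRing.Theory.

Local Open Scope classical_set_scope.
Local Open Scope card_scope.

Record relSet : Type := RelSet {
  carrier :> Type;
  srel : carrier -> carrier -> Prop;
  srel_refl : forall x, srel x x;
  srel_sym : forall x y, srel x y -> srel y x }.

Definition graph (E : relSet) : set (E * E) := [set p | srel p.1 p.2].
Arguments graph E _ : clear implicits.

Definition isIso (E E' : relSet) (f : E -> E') : Prop :=
  bijective f /\ (fun p => (f p.1, f p.2)) @` graph E = graph E'.

Definition isomorphic (E E' : relSet) : Prop := exists f : E -> E', isIso f.

Record finsub (T : Type) : Type := FinSub {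
  fsval :> set T;
  fsvalP : finite_set fsval }.

Lemma fsval_inj (T : Type) : injective (@fsval T).
Proof.
move=> [A Af] [B Bf] /= AB; subst B.
by congr FinSub; exact: Prop_irrelevance.
Qed.

HB.instance Definition _ (T : Type) := gen_eqMixin (finsub T).
HB.instance Definition _ (T : Type) := gen_choiceMixin (finsub T).

Section FinSubVectorSpace.
Variable T : Type.
Implicit Types X Y Z : finsub T.

Definition finsub0 : finsub T := FinSub (finite_set0 T).

Lemma finsub_addP X Y : finite_set (fsval X `+` fsval Y).
Proof.
by rewrite finite_setU; split; apply: finite_setD; exact: fsvalP.
Qed.

Definition finsub_add X Y : finsub T := FinSub (finsub_addP X Y).

Lemma finsub_addA : associative finsub_add.
Proof. by move=> X Y Z; apply: fsval_inj; exact: setYA. Qed.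

Lemma finsub_addC : commutative finsub_add.
Proof. by move=> X Y; apply: fsval_inj; exact: setYC. Qed.

Lemma finsub_add0 : left_id finsub0 finsub_add.
Proof. by move=> X; apply: fsval_inj; exact: set0Y. Qed.

Lemma finsub_addN : left_inverse finsub0 id finsub_add.
Proof. by move=> X; apply: fsval_inj; exact: setYK. Qed.

HB.instance Definition _ := GRing.isZmodule.Build (finsub T)
  finsub_addA finsub_addC finsub_add0 finsub_addN.

Definition finsub_scale (a : 'F_2) X : finsub T :=
  if a == 0%R then finsub0 else X.

Lemma finsub_scaleA a b X :
  finsub_scale a (finsub_scale b X) = finsub_scale (a * b)%R X.
Proof. by rewrite /finsub_scale mulf_eq0; case: (a == 0%R). Qed.

Lemma finsub_scale1 : left_id 1%R finsub_scale.
Proof. by []. Qed.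

Lemma finsub_scaleDr : right_distributive finsub_scale +%R.
Proof.
move=> a X Y; rewrite /finsub_scale; case: (a == 0%R) => //.
by rewrite [RHS]finsub_add0.
Qed.

Lemma finsub_scaleDl X :
  {morph finsub_scale^~ X : a b / (a + b)%R >-> (a + b)%R}.
Proof.
have XX : (X + X = finsub0)%R by exact: finsub_addN.
have F2 (a : 'F_2) : a = 0%R \/ a = 1%R.
  by case: a => [[|[|//]] ?]; [left | right]; exact: val_inj.
move=> a b; rewrite /finsub_scale.
case: (F2 a) => ->; case: (F2 b) => ->.
- by rewrite [RHS]finsub_add0.
- by rewrite [RHS]finsub_add0.
- by rewrite [RHS]finsub_addC [RHS]finsub_add0.
- by rewrite [RHS]XX.
Qed.

HB.instance Definition _ := GRing.Zmodule_isLmodule.Build 'F_2 (finsub T)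
  finsub_scaleA finsub_scale1 finsub_scaleDr finsub_scaleDl.

Definition subsetSpace (A : set T) : set (finsub T) := [set X | fsval X `<=` A].

End FinSubVectorSpace.

Section Cells.
Variable E : relSet.
Implicit Types (X N : set E) (x y : E).

Definition commutant X : set E := [set y | forall x, X x -> srel x y].

Definition commutative_set X : Prop := forall x y, X x -> X y -> srel x y.

Definition finsub_comm : set (finsub E) :=
  [set X | commutative_set (fsval X)].

Definition cell x : set E := commutant (commutant [set x]).

Definition kernel_of x : set E := [set y | cell x = cell y].

Definition kernels : set (set E) := range kernel_of.

(* All the elements of a kernel have the same cell (lemma [CelE]), so this
   union is that common cell. *)
Definition Cel N : set E := \bigcup_(x in N) cell x.

Lemma CelE N x : kernels N -> N x -> Cel N = cell x.
Proof.
move=> [a _ <-] /= ax; apply/seteqP; split=> [z [y /= ay]|z xz].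
  by rewrite -ax ay.
by exists x.
Qed.

Lemma kernels_comm N : kernels N -> commutative_set N.
Proof.
move=> [a _ <-] x y /= ax ay.
have cy : cell y y by move=> z zy; apply: srel_sym; exact: zy.
by move: cy; rewrite -{1}ay ax; apply=> z ->; exact: srel_refl.
Qed.

Definition setR (X Y : set E) : Prop := forall x y, X x -> Y y -> srel x y.

Definition kernelR (N M : kernels) : Prop := setR (val N) (val M).

Lemma kernelR_refl (N : kernels) : kernelR N N.
Proof. exact: kernels_comm (set_valP N). Qed.

Lemma kernelR_sym (N M : kernels) : kernelR N M -> kernelR M N.
Proof. by move=> NM x y Mx Ny; apply: srel_sym; exact: NM. Qed.

Definition kernelRelSet : relSet := RelSet kernelR_refl kernelR_sym.

End Cells.

Arguments finsub_comm E _ : clear implicits.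
Arguments kernels E _ : clear implicits.

(* Main.v *)
Require Import Defs.
From mathcomp Require Import all_boot all_order all_algebra.
From mathcomp Require Import boolp classical_sets functions cardinality.
From mathcomp Require wochoice.
Local Open Scope classical_set_scope.
Local Open Scope card_scope.
Set Implicit Arguments.
Unset Strict Implicit.
Unset Printing Implicit Defensive.
Import GRing.Theory.

(** Two finite commutative sets X, Y satisfy X R_P Y iff X + Y is commutative.
    So phi preserves R_P between finite commutative sets, hence maps [C^2(X)]
    onto [C^2(phi X)].  Single-point cells are recovered because x lies in
    phi^-1 {x'} for some x' in phi {x}, and then C^2(x') = C^2(phi {x}).  Inside
    a cell C^2(x), the points outside the kernel N of x are those whose cell is
    smaller, so phi also preserves [C^2(x) \ N]; the quotient has dimension
    #|N|, and comparing dimensions gives the equality of cardinals. *)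

(** * Finite subsets as vectors over ['F_2], and additive maps between them *)

Section FiniteSubsets.
Variable T : Type.
Implicit Types (X Y : finsub T) (x y : T).

Definition finsub1 x : finsub T := FinSub (finite_set1 x).

Lemma finsubDE X Y : fsval (X + Y)%R = fsval X `+` fsval Y.
Proof. by []. Qed.

Lemma finsub0E : fsval (0%R : finsub T) = set0.
Proof. by []. Qed.

Lemma finsubDD X : (X + X)%R = 0%R :> finsub T.
Proof. exact: finsub_addN. Qed.

Lemma finsubDKl X Y : (X + (X + Y))%R = Y.
Proof. by rewrite addrA finsubDD add0r. Qed.

Lemma finsubD_eq0 X Y : (X + Y)%R = 0%R -> X = Y.
Proof. by move=> XY; rewrite -[RHS](finsubDKl X) XY addr0. Qed.

(** Induction on cardinality, splitting off a point by [X = {x} + (X \ x)]. It stands in for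
    expansion in the basis of singletons. *)
Lemma finsub_ind (P : finsub T -> Prop) : P 0%R ->
  (forall x X, ~ fsval X x -> P X -> P (finsub1 x + X)%R) -> forall X, P X.
Proof.
move=> P0 PS X; have /finite_setP[n] := fsvalP X.
elim: n X => [|n IHn] X.
  rewrite II0 card_eq0 => /eqP X0; suff -> : X = 0%R by [].
  exact: fsval_inj.
move=> /eq_cardSP[x Xx Xn].
have DX : finite_set (fsval X `\ x) by apply: finite_setD; exact: fsvalP.
have -> : X = (finsub1 x + FinSub DX)%R.
  apply: fsval_inj; rewrite finsubDE /=; apply/seteqP; split=> y /=.
    by have [->|yx] := pselect (y = x); [left; split=> // -[]|right].
  by move=> [[->]|[[]]].
by apply: PS; [move=> [_ /(_ erefl)]|exact: IHn].
Qed.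

End FiniteSubsets.

Section Additive.
Variables (T T' : Type) (f : finsub T -> finsub T').
Hypothesis fD : {morph f : X Y / (X + Y)%R}.

Lemma additive0 : f 0%R = 0%R.
Proof. by have := fD 0%R 0%R; rewrite addr0 finsubDD. Qed.

Lemma additive_sub_span (A : set T) (B : set T') :
  (forall x, A x -> fsval (f (finsub1 x)) `<=` B) ->
  forall X, fsval X `<=` A -> fsval (f X) `<=` B.
Proof.
move=> AB; elim/finsub_ind => [|x X nXx IH XA].
  by rewrite additive0 => _ y [].
rewrite fD finsubDE => y [[+ _]|[+ _]].
  by apply: AB; apply: XA; left.
apply: IH => z Xz; apply: XA; right; split=> //= zx.
by apply: nXx; rewrite -zx.
Qed.

End Additive.

(** * Well-orders, leading terms and comparison of dimensions *)

Lemma well_order_exists (T : Type) : exists le : T -> T -> Prop,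
  [/\ forall x y, le x y \/ le y x,
      forall x y, le x y -> le y x -> x = y,
      forall x y z, le x y -> le y z -> le x z &
      forall A : set T, A !=set0 -> exists2 x, A x & forall y, A y -> le x y].
Proof.
have [R Rwo] := wochoice.well_ordering_principle {classic T}.
(* Every nonempty set has a unique minimum. The order axioms come from minima of sets of at most
   three points, antisymmetry using uniqueness. *)
have minR (A : set T) : A !=set0 -> exists2 x, A x & forall y, A y -> R x y.
  move=> [a Aa].
  have [|m [[mA mle] _]] := Rwo [pred x : {classic T} | `[< A x >]].
    by exists a; exact/asboolP.
  exists m; first exact/asboolP.
  by move=> y Ay; apply: mle; exact/asboolP.
have asym x y : R x y -> R y x -> x = y.
  move=> xy yx; have Rxx z : R z z.
    by have [|m -> mle] := minR [set z]; [exists z|exact: mle].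
  have [|m [_ mU]] := Rwo [pred z : {classic T} | `[< z = x \/ z = y >]].
    by exists x; apply/asboolP; left.
  have mx : m = x.
    by apply: mU; split; [apply/asboolP; left|move=> z /asboolP[->|->]].
  rewrite -mx; apply: mU; split; first by apply/asboolP; right.
  by move=> z /asboolP[->|->].
exists (fun x y => R x y); split=> // [x y|x y z xy yz].
- have [|m [->|->] mle] := minR [set x; y]; first by exists x; left.
    by left; apply: mle; right.
  by right; apply: mle; left.
- have [|m + mle] := minR [set t | t = x \/ t = y \/ t = z].
    by exists x; left.
  move=> [mE|[mE|mE]].
  + by rewrite -mE; apply: mle; right; right.
  + have -> // : x = y.
    by apply: asym => //; rewrite -mE; apply: mle; left.
  + have <- // : y = z.
    by apply: asym => //; rewrite -mE; apply: mle; right; left.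
Qed.

Section LeadingTerm.
Variables (T : Type) (le : T -> T -> Prop).
Hypotheses (le_total : forall x y, le x y \/ le y x)
           (le_trans : forall x y z, le x y -> le y z -> le x z).

Definition lead (X : finsub T) (x : T) :=
  fsval X x /\ forall y, fsval X y -> le y x.

Lemma lead_exists X : X <> 0%R -> exists x, lead X x.
Proof.
elim/finsub_ind: X => // x X nXx IH _.
have mem y : fsval (finsub1 x + X)%R y <-> y = x \/ fsval X y.
  rewrite finsubDE /=; split=> [[[]|[]]|]; [by left|by right|].
  move=> [->|Xy]; first by left.
  by right; split=> // yx; apply: nXx; rewrite -yx.
have lexx y : le y y by case: (le_total y y).
have [X0|/IH[m [Xm mle]]] := pselect (X = 0%R).
  exists x; split; first by apply/mem; left.
  by move=> y /mem[->|]; rewrite ?X0.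
case: (le_total x m) => xm.
  by exists m; split=> [|y /mem[->|/mle]//]; apply/mem; right.
exists x; split=> [|y /mem[->//|/mle ym]]; first by apply/mem; left.
exact: le_trans xm.
Qed.

End LeadingTerm.

(* Dimension comparison: well-order both index sets.  For i in A, the span of
   the h {x} with x <= i strictly contains the span over x < i, so it has a
   leading term that the latter lacks; send i to such a leading term. *)
Lemma additive_inj_card_le (T T' : Type) (h : finsub T -> finsub T')
    (A : set T) (B : set T') :
  {morph h : X Y / (X + Y)%R} ->
  (forall X, fsval X `<=` A -> fsval (h X) `<=` B) ->
  (forall X, fsval X `<=` A -> h X = 0%R -> X = 0%R) ->
  A #<= B.
Proof.
move=> hD hAB hinj.
have [le [le_total le_anti le_trans _]] := well_order_exists T.
have [le' [le'_total le'_anti le'_trans le'_min]] := well_order_exists T'.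
pose D i : set T := [set x | A x /\ le x i].
pose W (S : set T) : set (finsub T') := h @` subsetSpace S.
pose L (V : set (finsub T')) : set T' :=
  [set s | exists2 w, V w & lead le' w s].
have WD S v w : W S v -> W S w -> W S (v + w)%R.
  move=> [X XS <-] [Y YS <-]; exists (X + Y)%R => //.
  by rewrite /subsetSpace /= => x [[/XS]|[/YS]].
have DltD i : D i `\ i `<=` D i by move=> x [].
have LS S S' : S `<=` S' -> L (W S) `<=` L (W S').
  move=> SS' s [_ [X XS <-] ls]; exists (h X) => //; exists X => //.
  exact: subset_trans SS'.
have newlead i : A i -> exists s, L (W (D i)) s /\ ~ L (W (D i `\ i)) s.
  move=> Ai; apply: contrapT => nex.
  have LL s : L (W (D i)) s -> L (W (D i `\ i)) s.
    by move=> Ls; apply: contrapT => nLs; apply: nex; exists s.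
  have W0 S : W S 0%R by exists 0%R; [move=> x | exact: additive0].
  pose V : set (finsub T') := [set w | W (D i) w /\ ~ W (D i `\ i) w].
  have Vlead w : V w -> exists s, lead le' w s.
    by move=> [_ nW]; apply: lead_exists => // w0; apply: nW; rewrite w0.
  have Vhi : V (h (finsub1 i)).
    split.
      exists (finsub1 i) => // x ->; split=> //.
      by case: (le_total i i).
    move=> [X XD hX].
    have : (finsub1 i + X)%R = 0%R.
      apply: hinj; last by rewrite hD hX finsubDD.
      by move=> x [[->]|[/XD[[]]]].
    move=> /finsubD_eq0 iX.
    by have [_ /(_ erefl)] : (D i `\ i) i by apply: XD; rewrite -iX.
  (* Take [w] in [V] with least possible leading term [s], and [u] outside [V] with the same leading
     term. Then [w + u] is still in [V], but [s] cancels, so its leading term is below [s]: a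
     contradiction. *)
  have [|s [w Vw ws] smin] := le'_min (L V).
    by have [s si] := Vlead _ Vhi; exists s, (h (finsub1 i)).
  have [u Wu us] : L (W (D i `\ i)) s by apply: LL; exists w => //; case: Vw.
  have Vwu : V (w + u)%R.
    split.
      apply: WD; first by case: Vw.
      by case: Wu => X XD <-; exists X => //; exact: subset_trans (DltD i).
    move=> Wwu; case: Vw => _; apply.
    have -> : w = (u + (w + u))%R by rewrite addrCA finsubDD addr0.
    exact: WD.
  have [t tlead] := Vlead _ Vwu.
  have st : le' s t by apply: smin; exists (w + u)%R.
  case: tlead => wut _.
  have ts : le' t s.
    move: wut; rewrite finsubDE => -[[+ _]|[+ _]].
      by case: ws => _; apply.
    by case: us => _; apply.
  have E := le'_anti _ _ st ts; move: wut; rewrite -E finsubDE.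
  by case: ws => ws _; case: us => us _; case=> -[].
have [c cP] := choice (fun i : A => newlead (val i) (set_valP i)).
have cinj : injective c.
  (* If [i] is strictly below [j], then [D i] lies in [D j] without [j], so [c i] is one of the
     leading terms that [c j] was chosen to avoid. *)
  have aux i j : le (val i) (val j) -> c i = c j -> i = j.
    move=> ij cij; apply: contrapT => nij.
    have [Lci _] := cP i; have [_ nLcj] := cP j; apply: nLcj; rewrite -cij.
    apply: LS Lci => x [Ax xi]; split; first by split=> //; exact: le_trans ij.
    move=> /= xj; apply: nij; apply: val_inj; apply: le_anti => //.
    by move: xi; rewrite xj.
  move=> i j cij; case: (le_total (val i) (val j)) => ij; first exact: aux.
  by apply/esym/aux.
apply/card_subP; exists (range c).
  apply: card_eq_trans (card_setT A); apply: inj_card_eq.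
  by move=> x y _ _; exact: cinj.
move=> _ [i _ <-]; have [[_ [X XD <-] [hXc _]] _] := cP i.
by apply: hAB hXc => x /XD[].
Qed.

(** * Commutants, cells and kernels *)

Section Commutant.
Variable E : relSet.
Implicit Types (S : set E) (X Y Z : finsub E) (x y : E).

Local Notation C2 S := (commutant (commutant S)).

Lemma commutantS S S' : S `<=` S' -> commutant S' `<=` commutant S.
Proof. by move=> SS' y yS' x /SS'; exact: yS'. Qed.

Lemma sub_commutant2 S : S `<=` C2 S.
Proof. by move=> x Sx y; move/(_ _ Sx)/srel_sym. Qed.

Lemma commutant2_sub S S' : S `<=` C2 S' -> C2 S `<=` C2 S'.
Proof.
move=> SS'; apply: commutantS; apply: subset_trans (commutantS SS').
exact: sub_commutant2.
Qed.

Lemma commutant2_comm S : commutative_set S -> commutative_set (C2 S).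
Proof.
move=> Sc y z yS zS; apply: zS.
by apply: commutantS yS => u Su v Sv; exact: Sc.
Qed.

Lemma setR_commutant2 S S' : setR S S' -> setR (C2 S) (C2 S').
Proof.
move=> SS' x y xS yS'; apply: yS' => z zS'.
by apply: xS => w Sw; exact: SS'.
Qed.

Lemma cell_self x : cell x x.
Proof. exact: sub_commutant2. Qed.

Lemma cell_sub x y : cell x y -> cell y `<=` cell x.
Proof. by move=> xy; apply: commutant2_sub => _ ->. Qed.

Lemma finsub1_comm x : finsub_comm E (finsub1 x).
Proof. by move=> _ _ -> ->; exact: srel_refl. Qed.

(** A point of [X] and a point of [Y] both survive in the symmetric difference unless one of them
    lies in both sets; in that case commutativity of [X] or of [Y] relates them. This expresses
    [setR] through addition and commutativity alone. *)
Lemma finsubD_comm X Y : finsub_comm E X -> finsub_comm E Y ->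
  finsub_comm E (X + Y)%R <-> setR (fsval X) (fsval Y).
Proof.
move=> Xc Yc; split=> [XYc x y Xx Yy | XY x y].
  have [Yx|nYx] := pselect (fsval Y x); first exact: Yc.
  have [Xy|nXy] := pselect (fsval X y); first exact: Xc.
  by apply: XYc; rewrite finsubDE; [left|right].
rewrite finsubDE => -[[Xx _]|[Yx _]] [[Xy _]|[Yy _]].
- exact: Xc.
- exact: XY.
- by apply: srel_sym; exact: XY.
- exact: Yc.
Qed.

(** The right side involves only finite commutative sets and [setR], hence can be transported.
    Testing it on singletons [Z] already reaches every point of the commutant of [X]. *)
Lemma commutant2P X Y : finsub_comm E X ->
  fsval Y `<=` C2 (fsval X) <->
  finsub_comm E Y /\ forall Z, finsub_comm E Z ->
    setR (fsval Z) (fsval X) -> setR (fsval Z) (fsval Y).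
Proof.
move=> Xc; split=> [YX|[Yc YZ] y Yy z zX].
  split=> [x y /YX xX /YX yX|Z _ ZX z y Zz /YX yX].
    exact: (commutant2_comm Xc).
  by apply: yX => x Xx; apply: srel_sym; exact: ZX.
apply: (YZ _ (@finsub1_comm z)) => // _ x -> Xx.
by apply: srel_sym; exact: zX.
Qed.

Lemma kernel_of_self x : kernel_of x x.
Proof. by []. Qed.

Lemma kernel_of_cell x y : cell x = cell y -> kernel_of x = kernel_of y.
Proof. by rewrite /kernel_of => ->. Qed.

Lemma Cel_kernel_of x : Cel (kernel_of x) = cell x.
Proof. by apply: CelE; [exists x|exact: kernel_of_self]. Qed.

Definition kernel x : kernels E := exist _ (kernel_of x) (mem_set (imageT _ x)).

Lemma kernelP (N : kernels E) x : val N x -> N = kernel x.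
Proof.
case: N => _ /[dup] /set_mem[y _ <-] mN /= yx; apply: val_inj => /=.
exact: kernel_of_cell.
Qed.

Lemma kernel_surj (N : kernels E) : exists x, N = kernel x.
Proof.
have [x _ xN] := set_valP N; exists x; apply: kernelP.
by rewrite -xN.
Qed.

Lemma Cel_inj (N M : kernels E) : Cel (val N) = Cel (val M) -> N = M.
Proof.
have [x ->] := kernel_surj N; have [y ->] := kernel_surj M.
by rewrite !Cel_kernel_of => /kernel_of_cell xy; exact: val_inj.
Qed.

(** A relation between two points extends to their cells, which contain their kernels. *)
Lemma kernelR_kernel x y : kernelR (kernel x) (kernel y) <-> srel x y.
Proof.
split=> [|xy u v /= xu yv]; first by apply; exact: kernel_of_self.
apply: (@setR_commutant2 [set x] [set y]); first by move=> _ _ -> ->.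
  by rewrite -/(cell x) xu; exact: cell_self.
by rewrite -/(cell y) yv; exact: cell_self.
Qed.

End Commutant.

Lemma subsetSpaceP (T : Type) (A B : set T) :
  (forall X, fsval X `<=` A -> fsval X `<=` B) -> A `<=` B.
Proof. by move=> AB x Ax; apply: (AB (finsub1 x)) => // _ ->. Qed.

Lemma subsetSpace_inj (T : Type) (A B : set T) :
  subsetSpace A = subsetSpace B -> A = B.
Proof.
move=> AB; have memAB X : subsetSpace A X <-> subsetSpace B X by rewrite AB.
by apply/seteqP; split; apply: subsetSpaceP => X /memAB.
Qed.

(** * Transport of double commutants and cells *)

Definition clique_iso (E E' : relSet) (f : finsub E -> finsub E')
    (g : finsub E' -> finsub E) : Prop :=
  [/\ {morph f : X Y / (X + Y)%R}, cancel f g, cancel g f &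
      forall X, finsub_comm E X <-> finsub_comm E' (f X)].

(** Carrying the inverse explicitly makes the situation symmetric: each result about [f] also
    applies to [g]. *)
Lemma clique_iso_sym (E E' : relSet) (f : finsub E -> finsub E') g :
  clique_iso f g -> clique_iso g f.
Proof.
move=> [fD fK gK fc]; split=> // [X Y|X]; last by rewrite fc gK.
by apply: (can_inj fK); rewrite fD !gK.
Qed.

(** For bijective [f] this is $f([C^2(x)])=[C^2(x')]$, as [cell_match_image] confirms; the pointwise
    equivalence reverses easily. *)
Definition cell_match (E E' : relSet) (f : finsub E -> finsub E') x x' : Prop :=
  forall Y, fsval Y `<=` cell x <-> fsval (f Y) `<=` cell x'.

Section CliqueIso.
Variables (E E' : relSet) (f : finsub E -> finsub E') (g : finsub E' -> finsub E).
Hypothesis fg : clique_iso f g.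

Local Notation C2 S := (commutant (commutant S)).

Let fD : {morph f : X Y / (X + Y)%R}. Proof. by case: fg. Qed.
Let fK : cancel f g. Proof. by case: fg. Qed.
Let gK : cancel g f. Proof. by case: fg. Qed.
Let fc X : finsub_comm E X <-> finsub_comm E' (f X).
Proof. by case: fg. Qed.
Let gD : {morph g : X Y / (X + Y)%R}.
Proof. by case: (clique_iso_sym fg). Qed.

Lemma cell_match_sym x x' : cell_match f x x' -> cell_match g x' x.
Proof. by move=> xx' Y; rewrite xx' gK. Qed.

Lemma clique_iso_setR X Y : finsub_comm E X -> finsub_comm E Y ->
  setR (fsval X) (fsval Y) <-> setR (fsval (f X)) (fsval (f Y)).
Proof.
move=> Xc Yc; rewrite -finsubD_comm // fc fD finsubD_comm //; exact/fc.
Qed.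

(** Both sides unfold by [commutant2P], and the test sets [Z] correspond under [f] and [g]. *)
Lemma clique_iso_commutant2 X Y : finsub_comm E X ->
  fsval Y `<=` C2 (fsval X) <-> fsval (f Y) `<=` C2 (fsval (f X)).
Proof.
move=> Xc; have fXc : finsub_comm E' (f X) by apply/fc.
rewrite !commutant2P //; split=> -[Yc YZ].
  split=> [|Z Zc ZX]; first exact/fc.
  have gZc : finsub_comm E (g Z) by apply/fc; rewrite gK.
  rewrite -(gK Z) -clique_iso_setR //; apply: YZ => //.
  by apply/clique_iso_setR; rewrite ?gK.
have {}Yc : finsub_comm E Y by apply/fc.
split=> // Z Zc ZX; apply/clique_iso_setR => //.
by apply: YZ; [exact/fc|exact/clique_iso_setR].
Qed.

Lemma cell_match_exists x : exists x', cell_match f x x'.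
Proof.
(* Otherwise [g] sends every singleton of [f {x}] to a set missing [x], so by additivity
   [g (f {x}) = {x}] would miss [x]. *)
have [x' x'fx xgx'] : exists2 x', fsval (f (finsub1 x)) x' &
    fsval (g (finsub1 x')) x.
  apply: contrapT => nex.
  have : fsval (g (f (finsub1 x))) `<=` ~` [set x].
    apply: (additive_sub_span gD (A := fsval (f (finsub1 x)))) => //.
    move=> x' x'fx y ygx' yx.
    by apply: nex; exists x' => //; rewrite -yx.
  by rewrite fK => /(_ x erefl) /(_ erefl).
exists x' => Y; rewrite /cell -[[set x]]/(fsval (finsub1 x)).
rewrite clique_iso_commutant2; last exact: finsub1_comm.
(* One inclusion holds because [x'] lies in [f {x}]. The other is pulled back by [g], where it
   becomes $C^2(x)\subseteq C^2(g\{x'\})$ and holds because [x] lies in [g {x'}]. *)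
suff -> : C2 (fsval (f (finsub1 x))) = C2 [set x'] by [].
apply/seteqP; split; last first.
  by apply: commutant2_sub => _ ->; exact: sub_commutant2.
apply: subsetSpaceP => X; rewrite -{1}(gK X) -clique_iso_commutant2; last first.
  exact: finsub1_comm.
move=> gX; rewrite -(gK X) -[[set x']]/(fsval (finsub1 x')) -(gK (finsub1 x')).
rewrite -clique_iso_commutant2.
  apply: subset_trans gX _; apply: commutant2_sub => _ ->.
  exact: sub_commutant2.
by apply/fc; rewrite gK; exact: finsub1_comm.
Qed.

(** A point [z] of [f {y}] in the kernel of [x'] would give $C^2(x')=C^2(z)\subseteq C^2(f\{y\})$;
    pulled back, [cell x] would lie in [cell y], making the two cells equal. *)
Lemma cell_match_miss_kernel x x' y : cell_match f x x' ->
  cell x y -> cell x <> cell y ->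
  fsval (f (finsub1 y)) `<=` ~` kernel_of x'.
Proof.
move=> xx' xy nxy z zfy zx'; apply: nxy; apply/seteqP.
split; last exact: cell_sub.
apply: subsetSpaceP => Y /xx' Yx'; rewrite /cell -[[set y]]/(fsval (finsub1 y)).
apply/clique_iso_commutant2; first exact: finsub1_comm.
apply: subset_trans Yx' _; rewrite zx'.
by apply: commutant2_sub => _ ->; exact: sub_commutant2.
Qed.

(** The sets [g {x'}] and [g {y'}] lie in the cells of [x] and [y], which are related pointwise; [f]
    carries this back to [x'] and [y']. *)
Lemma cell_match_srel x x' y y' : cell_match f x x' -> cell_match f y y' ->
  srel x y -> srel x' y'.
Proof.
move=> xx' yy' xy.
have gx z z' : cell_match f z z' -> fsval (g (finsub1 z')) `<=` cell z.
  by move=> zz'; apply/zz'; rewrite gK => _ ->; exact: cell_self.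
have gc z' : finsub_comm E (g (finsub1 z')).
  by apply/fc; rewrite gK; exact: finsub1_comm.
suff : setR (fsval (g (finsub1 x'))) (fsval (g (finsub1 y'))).
  by rewrite clique_iso_setR // !gK; apply.
move=> u v /(gx _ _ xx') xu /(gx _ _ yy') yv.
by apply: setR_commutant2 xu yv => _ _ -> ->.
Qed.

End CliqueIso.

(* f maps [cell x] onto [cell x'] and, by [cell_match_miss_kernel] for both
   directions, [cell x \ kernel x] onto [cell x' \ kernel x'].  The induced
   isomorphism of the quotients is X |-> f X :&: kernel x' on [kernel x]. *)
Lemma cell_match_card_le (E E' : relSet) (f : finsub E -> finsub E') g x x' :
  clique_iso f g -> cell_match f x x' -> kernel_of x #<= kernel_of x'.
Proof.
move=> fg xx'; have [fD fK gK _] := fg; have gf := clique_iso_sym fg.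
have [gD _ _ _] := gf.
pose h X := FinSub (finite_setIl (kernel_of x') (fsvalP (f X))).
have kernel_cell (F : relSet) (z : F) : kernel_of z `<=` cell z.
  by move=> u /= ->; exact: cell_self.
apply: (@additive_inj_card_le _ _ h).
- by move=> X Y; apply: fsval_inj; rewrite /= fD finsubDE setIYl.
- by move=> X _ y [].
move=> X XN /(congr1 (@fsval _)) /= hX0; apply: fsval_inj; rewrite finsub0E.
(* Since [h X] is empty, [f X] avoids the kernel of [x']; pulling back, [X] avoids the kernel of [x]
   while being contained in it. *)
have fX : fsval (f X) `<=` cell x' `\` kernel_of x'.
  move=> z zfX; split.
    by apply: (xx' X).1 zfX; exact: subset_trans (kernel_cell _ _).
  by move=> zN; have : set0 z by rewrite -[set0]hX0.
have : fsval (g (f X)) `<=` ~` kernel_of x.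
  apply: (additive_sub_span gD) fX => z [x'z nz].
  exact: (cell_match_miss_kernel gf (cell_match_sym fg xx')).
by rewrite fK => nX; apply/seteqP; split=> // z zX; apply: (nX z zX); exact: XN.
Qed.

Lemma cell_match_card_eq (E E' : relSet) (f : finsub E -> finsub E') g x x' :
  clique_iso f g -> cell_match f x x' -> kernel_of x #= kernel_of x'.
Proof.
move=> fg xx'; apply: Cantor_Bernstein; first exact: cell_match_card_le fg xx'.
exact: cell_match_card_le (clique_iso_sym fg) (cell_match_sym fg xx').
Qed.

(** * The map on kernels and the isomorphism of relation sets *)

Lemma cell_match_image (E E' : relSet) (f : finsub E -> finsub E') g x x' :
  clique_iso f g ->
  cell_match f x x' <->
  f @` subsetSpace (Cel (val (kernel x))) =
    subsetSpace (Cel (val (kernel x'))).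
Proof.
move=> [_ fK gK _]; rewrite !Cel_kernel_of; split=> [xx'|fS Y].
  apply/seteqP; split=> [_ [X /xx' Xx' <-] //|X Xx'].
  by exists (g X); [apply/xx'; rewrite gK|exact: gK].
have -> : (fsval (f Y) `<=` cell x') = (f @` subsetSpace (cell x)) (f Y).
  by rewrite fS.
split=> [Yx|[X Xx /(can_inj fK) <-] //]; by exists Y.
Qed.

Lemma kernel_map_exists (E E' : relSet) (f : finsub E -> finsub E') g :
  clique_iso f g -> exists F : kernels E -> kernels E',
    forall N, f @` subsetSpace (Cel (val N)) = subsetSpace (Cel (val (F N))).
Proof.
move=> fg; suff /choice[F FP] : forall N : kernels E, exists N' : kernels E',
  f @` subsetSpace (Cel (val N)) = subsetSpace (Cel (val N')) by exists F.
move=> N; have [x ->] := kernel_surj N; have [x' xx'] := cell_match_exists fg x.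
by exists (kernel x'); apply/cell_match_image; first exact: fg.
Qed.

Lemma isIso_intro (E E' : relSet) (f : E -> E') : bijective f ->
  (forall x y, srel x y <-> srel (f x) (f y)) -> isIso f.
Proof.
move=> fbij fR; split=> //; have [g fK gK] := fbij.
apply/seteqP; split=> [_ [[x y] /= /fR xy <-] //|[x y] /= xy].
by exists (g x, g y); rewrite /= ?gK //; apply/fR; rewrite !gK.
Qed.

(** The point [u0] rules out an empty [U], over which no total map need exist. *)
Lemma card_eq_set_bij (T U : Type) (A : set T) (B : set U) (u0 : U) :
  A #= B -> exists f : T -> U, set_bij A B f.
Proof.
elim/Ppointed: U => U in B u0 *; first by have := no u0.
by move=> /card_set_bijP.
Qed.

Theorem mainTheorem1 (E E' : relSet) (phi : {linear finsub E -> finsub E'})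
    (phi_bij : bijective phi)
    (phi_comm : phi @` finsub_comm E = finsub_comm E') :
  (exists phiN : kernelRelSet E -> kernelRelSet E',
     [/\ forall (N : kernels E) (N' : kernels E'),
           phi @` subsetSpace (Cel (val N)) = subsetSpace (Cel (val N'))
           <-> N' = phiN N,
         isIso phiN
       & forall N : kernels E, val N #= val (phiN N : kernels E')])
  /\ isomorphic E E'.
Proof.
have [g phiK gK] := phi_bij.
have fg : clique_iso phi g.
  split=> // [X Y|X]; first exact: raddfD.
  rewrite -phi_comm; split=> [Xc|[Y Yc /(can_inj phiK) <-] //].
  by exists X.
have [F FP] := kernel_map_exists fg.
have [G GP] := kernel_map_exists (clique_iso_sym fg).
(* A kernel is determined by its cell, and a cell by its space of finite subsets, on which [g]
   undoes [phi]. *)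
have FK : cancel F G.
  move=> N; apply/Cel_inj/subsetSpace_inj; rewrite -GP -FP image_comp.
  by rewrite (_ : g \o phi = id) ?image_id //; apply/funext.
have GK : cancel G F.
  move=> N; apply/Cel_inj/subsetSpace_inj; rewrite -FP -GP image_comp.
  by rewrite (_ : phi \o g = id) ?image_id //; apply/funext.
have Fmatch x x' : kernel x' = F (kernel x) -> cell_match phi x x'.
  by move=> Kx'; apply/(cell_match_image _ _ fg); rewrite Kx'.
have Fcard N : val N #= val (F N).
  have [x Nx] := kernel_surj N; have [x' Nx'] := kernel_surj (F N).
  rewrite Nx' Nx; apply: cell_match_card_eq fg _.
  by apply: Fmatch; rewrite -Nx' Nx.
(* This serves twice: for representatives of kernels, and for the points [x] and [b x] below. *)
have FR x x' y y' : kernel x' = F (kernel x) -> kernel y' = F (kernel y) ->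
    srel x y <-> srel x' y'.
  move=> /Fmatch xx' /Fmatch yy'.
  split; first exact: (cell_match_srel fg xx' yy').
  exact: (cell_match_srel (clique_iso_sym fg) (cell_match_sym fg xx')
           (cell_match_sym fg yy')).
split.
  exists F; split=> //.
    move=> N N'; split=> [|->]; last exact: FP.
    by rewrite FP => /subsetSpace_inj/Cel_inj.
  apply: isIso_intro; first by exists G.
  move=> N M; have [x Nx] := kernel_surj N; have [y My] := kernel_surj M.
  have [x' Nx'] := kernel_surj (F N); have [y' My'] := kernel_surj (F M).
  rewrite /= Nx' My' Nx My !kernelR_kernel.
  by apply: FR; [rewrite -Nx' Nx|rewrite -My' My].
(* Equal cardinality gives a bijection from each kernel to its image; gluing these over the
   partition into kernels yields [b]. *)
have uP (N : kernels E) : exists u : E -> E', set_bij (val N) (val (F N)) u.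
  have [x' Nx'] := kernel_surj (F N).
  exact: card_eq_set_bij x' (Fcard N).
have [u {}uP] := choice uP.
pose b x := u (kernel x) x.
have bF x : kernel (b x) = F (kernel x).
  apply/esym/kernelP; have [uF _ _] := uP (kernel x).
  exact: uF (kernel_of_self x).
exists b; apply: isIso_intro => [|x y]; last exact: FR.
(* If [b x = b y], then [F] sends both kernels to the same one, so they coincide and the local
   bijection separates points. A preimage of [x'] is found in the kernel [G (kernel x')]. *)
rewrite -setTT_bijective; split=> // [x y _ _ bxy|x' _].
  have Kxy : kernel x = kernel y by apply: (can_inj FK); rewrite -!bF bxy.
  have [_ uI _] := uP (kernel x); apply: uI; rewrite ?inE.
  - exact: kernel_of_self.
  - by rewrite Kxy; exact: kernel_of_self.
  - by rewrite {2}Kxy.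
have [_ _ /(_ x')[|x Nx xx']] := uP (G (kernel x')).
  by rewrite GK; exact: kernel_of_self.
by exists x => //; rewrite -xx' /b -(kernelP Nx).
Qed.
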